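(* Let $T$ be an ideal triangle in the projective model $(\mathbb{B}^2,d_h)$ of the hyperbolic plane. Then there are $\delta_0>0$ and positive constants $C_1,C_2$ such that $$C_1\le\frac{\mathrm{vol}_2^h(T)-\mathrm{vol}_2^h(T_\delta^h)}{\delta}\le C_2$$ for all $0<\delta<\delta_0$, where $T_\delta^h$ is the hyperbolic floating body of $T$.
   Context: The projective model of the hyperbolic plane is the open Euclidean unit disk $\mathbb{B}^2\subset\mathbb{R}^2$ with distance $d_h(x,y)=\frac12\ln\left(\frac{\|y-p\|}{\|x-p\|}\frac{\|x-q\|}{\|y-q\|}\right)$, where $p,q$ are the intersection points of the line through $x,y$ with the unit circle $\mathbb{S}^1$, and $p,x,y,q$ lie in that order on the line. Geodesics are Euclidean straight lines intersected with $\mathbb{B}^2$. The hyperbolic area is $\mathrm{vol}_2^h(A)=\int_{A\cap\mathbb{B}^2}(1-\|x\|^2)^{-3/2}\,dx$. An ideal triangle is the convex hull of three distinct points of $\mathbb{S}^1$ (all its vertices lie at infinity); it has finite hyperbolic area. For a geodesic line $H$, $H^\pm$ denote the two closed half-planes bounded by $H$ (in either order). The hyperbolic floating body of $T$ is, for sufficiently small $\delta>0$, $$T_\delta^h=\bigcap\{H^-:\mathrm{vol}_2^h(T\cap H^+)\le\delta\}.$$ *)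

(* Defs.v *)
From HB Require Import structures.
From mathcomp Require Import all_boot all_order all_algebra.
From mathcomp Require Import all_classical all_reals all_analysis.
Set Implicit Arguments.
Unset Strict Implicit.
Unset Printing Implicit Defensive.
Import Order.TTheory GRing.Theory Num.Theory.
Import numFieldNormedType.Exports.
Local Open Scope classical_set_scope.
Local Open Scope ring_scope.

(* The library norm on R * R is the sup norm, hence the explicit Euclidean
   inner product. *)
Definition dot (R : realType) (x y : R * R) : R := x.1 * y.1 + x.2 * y.2.

Definition norm2 (R : realType) (x : R * R) : R := Num.sqrt (dot x x).

Definition open_disk (R : realType) : set (R * R) := [set x | norm2 x < 1].

Definition unit_circle (R : realType) : set (R * R) := [set x | norm2 x = 1].

(* Hyperbolic area in the projective model; `^ is the real power, whose base
   is positive on the disk. *)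
Definition hvol (R : realType) (A : set (R * R)) : \bar R :=
  (\int[lebesgue_measure \x lebesgue_measure]_(x in A `&` @open_disk R)
    ((1 - norm2 x ^+ 2) `^ (- (3 / 2)))%:E)%E.

(* The geodesic carried by the Euclidean line {x | <u, x> = c}, u <> 0. *)
Definition geodesic (R : realType) (u : R * R) (c : R) : set (R * R) :=
  @open_disk R `&` [set x | dot u x = c].

(* (u, c) represents a geodesic H together with an ordering (H^+, H^-) of the
   two closed half-planes it bounds; (- u, - c) gives the other ordering. *)
Definition oriented_geodesic (R : realType) : set ((R * R) * R) :=
  [set h | h.1 <> 0 /\ geodesic h.1 h.2 !=set0].

Definition hplane_pos (R : realType) (h : (R * R) * R) : set (R * R) :=
  @open_disk R `&` [set x | h.2 <= dot h.1 x].

Definition hplane_neg (R : realType) (h : (R * R) * R) : set (R * R) :=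
  @open_disk R `&` [set x | dot h.1 x <= h.2].

Definition floating_body (R : realType) (T : set (R * R)) (delta : R) :
    set (R * R) :=
  \bigcap_(h in [set h | oriented_geodesic h /\
                         (hvol (T `&` hplane_pos h) <= delta%:E)%E])
    hplane_neg h.

Definition convex_hull (R : realType) (A : set (R * R)) : set (R * R) :=
  \bigcap_(C in [set C : set (R * R) | convex_set (M := (R * R)%type) C /\ A `<=` C]) C.

(* The hull contains the three vertices, which lie at infinity; hvol only
   sees the part inside the disk. *)
Definition ideal_triangle (R : realType) (T : set (R * R)) : Prop :=
  exists a b c : R * R,
    [/\ @unit_circle R a, @unit_circle R b & @unit_circle R c] /\
    [/\ a <> b, b <> c & a <> c] /\
    T = convex_hull [set a; b; c].

(* Main.v *)
Require Import Defs.
From HB Require Import structures.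
From mathcomp Require Import all_boot all_order all_algebra.
From mathcomp Require Import all_classical all_reals all_analysis.
From mathcomp Require Import measurable_realfun ring lra.
Import Order.TTheory GRing.Theory Num.Theory.
Import numFieldNormedType.Exports.
Local Open Scope classical_set_scope.
Local Open Scope ring_scope.
Set Implicit Arguments.
Unset Strict Implicit.
Unset Printing Implicit Defensive.

(** Why the theorem holds.

    Everything is read off in barycentric coordinates (al, be, ga) with respect
    to the vertices a, b, c of T.  Since the vertices are unit vectors,
      1 - |x|^2 = al be |a - b|^2 + be ga |b - c|^2 + ga al |c - a|^2
    ([bary_unit_circle]), so the hyperbolic density is controlled by an
    elementary function of the coordinates.  Two estimates at the scale
    sqrt(e) carry the proof.

    Strips are small ([hvol_strip_le]): the part of T on which ga <= e has
    area at most C sqrt(e).  There one of al, be is at least 1/3, so the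
    density is at most a constant times
    (al + ga)^(-3/2) + (be + ga)^(-3/2), and
    int_0^e int_0^1 (u + v)^(-3/2) du dv <= int_0^e 2 v^(-1/2) dv = 4 sqrt(e).

    Caps are not smaller ([hvol_halfplane_ge]): if a half-plane contains the
    point (1 - s) a + s g, where g is the centroid, then it cuts off from T an
    area at least c sqrt(s).  The homothety of ratio s centred at a maps a
    fixed square around g to a square of side proportional to s inside T, a
    quarter of which lies in the half-plane, and there the density is at least
    (4 s)^(-3/2).

    Upper bound: choose s with c sqrt(s) = 2 delta.  No half-plane that cuts
    off area at most delta contains one of the three points (1 - s) v + s g, so
    the floating body contains the triangle they span, which is the set where
    all three coordinates are at least s/3.  The rest of T is covered by three
    strips of total area at most a constant times sqrt(s), that is, times delta.

    Lower bound: choose e with C sqrt(e) = delta.  The strip ga <= e is then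
    cut off by an admissible half-plane, so the floating body misses the strip
    ga < e; this strip contains the cap ga <= e/2, of area at least
    c sqrt(e) = (c/C) delta. *)

(** * Affine changes of variables in the plane *)

Lemma ge0_integral_affine (R : realType) (k l : R) (f : R -> \bar R) :
  k != 0 -> measurable_fun [set: R] f -> (forall x, 0 <= f x)%E ->
  (\int[lebesgue_measure]_y f (k * y + l)%R =
   (`|k|^-1)%:E * \int[lebesgue_measure]_y f y)%E.
Proof.
move=> k0 mf f0; pose phi := fun y : R => k * y + l.
have mphi : measurable_fun [set: R] (phi : R -> measurableTypeR R).
  by apply: measurable_funD => //; apply: measurable_funM.
have knz : 0 < `|k| by rewrite normr_gt0.
pose K : {nonneg R} := NngNum (ltW knz).
(* The rescaled image of Lebesgue measure has the same value on intervals. *)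
pose nu0 : {measure set (measurableTypeR R) -> \bar R} :=
  mscale K (pushforward lebesgue_measure (phi : R -> measurableTypeR R)).
pose nu := nu0 mphi.
have nuE A : measurable A -> lebesgue_measure A = nu A.
  apply: lebesgue_measure_unique => _ [[a b]] _ <- /=.
  rewrite lebesgue_measure_itv /= lte_fin.
  rewrite /nu /nu0 /mscale /pushforward /= /phi.
  have [ k_gt0|k_lt0|/eqP] := ltgtP 0 k; last by rewrite eq_sym (negbTE k0).
    rewrite [X in (_ * lebesgue_measure X)%E](_ : _ =
      `](a - l) / k, (b - l) / k]%classic); last first.
      apply/seteqP; split=> x /=; rewrite !in_itv /= ltr_pdivrMr// ler_pdivlMr//;
      by move=> /andP[? ?]; apply/andP; split; lra.
    rewrite lebesgue_measure_itv /= lte_fin gtr0_norm//.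
    have -> : ((a - l) / k < (b - l) / k) = (a < b) by rewrite ltr_pM2r ?invr_gt0// ltrD2r.
    case: ifP => ab; last by rewrite mule0.
    by rewrite -!EFinB -EFinM; congr EFin; field.
  rewrite [X in (_ * lebesgue_measure X)%E](_ : _ =
    `[(b - l) / k, (a - l) / k[%classic); last first.
    apply/seteqP; split=> x /=; rewrite !in_itv /= ler_ndivrMr// ltr_ndivlMr//;
    by move=> /andP[? ?]; apply/andP; split; lra.
  rewrite lebesgue_measure_itv /= lte_fin ltr0_norm//.
  have -> : ((b - l) / k < (a - l) / k) = (a < b) by rewrite ltr_nM2r ?invr_lt0// ltrD2r.
  case: ifP => ab; last by rewrite mule0.
  by rewrite -!EFinB -EFinM; congr EFin; field.
rewrite [in RHS](eq_measure_integral nu); last by move=> A mA _; exact: nuE.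
rewrite ge0_integral_mscale//= ge0_integral_pushforward//.
by rewrite muleA -EFinM mulVf ?gt_eqF// mul1e.
Qed.

Lemma measurable_affine2 (R : realType) (p q r p' q' r' : R) :
  measurable_fun [set: R * R]
    (fun z : R * R => (p * z.1 + q * z.2 + r, p' * z.1 + q' * z.2 + r')).
Proof.
apply/measurable_fun_pair; apply: measurable_funD => //; apply: measurable_funD;
  by apply: measurable_funM => //; exact: measurable_fst || exact: measurable_snd.
Qed.

Lemma ge0_integral_swap (R : realType) (f : R * R -> \bar R) :
  measurable_fun [set: R * R] f -> (forall z, 0 <= f z)%E ->
  (\int[lebesgue_measure \x lebesgue_measure]_z f (z.2, z.1) =
   \int[lebesgue_measure \x lebesgue_measure]_z f z)%E.
Proof.
move=> mf f0; rewrite fubini_tonelli1//; last first.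
  apply: measurableT_comp => //; apply/measurable_fun_pair => /=;
  [exact: measurable_snd|exact: measurable_fst].
by rewrite fubini_tonelli2.
Qed.

(** By Tonelli the substitution is done one variable at a time: first in the
    second variable, along the second output coordinate, then in the first.
    The first of these steps needs [q'] to be nonzero. *)
Lemma ge0_integral_affine2_wlog (R : realType) (p q r p' q' r' : R)
    (f : R * R -> \bar R) :
  p * q' - q * p' != 0 -> q' != 0 ->
  measurable_fun [set: R * R] f -> (forall z, 0 <= f z)%E ->
  (\int[lebesgue_measure \x lebesgue_measure]_z
      f (p * z.1 + q * z.2 + r, p' * z.1 + q' * z.2 + r')%R =
   (`|p * q' - q * p'|^-1)%:E *
   \int[lebesgue_measure \x lebesgue_measure]_z f z)%E.
Proof.
move=> D0 q'0 mf f0.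
have mF := measurable_affine2 p q r p' q' r'.
rewrite fubini_tonelli1//; last exact: measurableT_comp.
rewrite /fubini_F /=.
pose k := (p * q' - q * p') / q'.
pose g := fun z : R * R => (k * z.1 + q / q' * z.2 + (r - r' * (q / q')), 0 * z.1 + 1 * z.2 + 0).
have mg : measurable_fun [set: R * R] (f \o g).
  by apply: measurableT_comp => //; exact: measurable_affine2.
have -> : (\int[lebesgue_measure]_x \int[lebesgue_measure]_y
     f (p * x + q * y + r, p' * x + q' * y + r')%R =
   \int[lebesgue_measure]_x ((`|q'|^-1)%:E * \int[lebesgue_measure]_y (f \o g) (x, y)))%E.
  apply: eq_integral => x _.
  rewrite -(ge0_integral_affine (p' * x + r') q'0
    (measurableT_comp mg (pair1_measurable x)))//; last by move=> v; exact: f0.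
  apply: eq_integral => y _ /=; congr f; congr pair; rewrite /k /=; [by field|by ring].
rewrite ge0_integralZl//; last 2 first.
- apply: (measurable_fun_fubini_tonelli_F (m2 := lebesgue_measure) (f \o g)) => // z; exact: f0.
- by move=> x _; apply: integral_ge0 => y _; exact: f0.
rewrite (fubini_tonelli (m1 := lebesgue_measure) (m2 := lebesgue_measure)
  (f \o g))//; [|by move=> z; exact: f0].
have k0 : k != 0 by rewrite mulf_neq0 ?invr_neq0.
have -> : (\int[lebesgue_measure]_y \int[lebesgue_measure]_x (f \o g) (x, y) =
   \int[lebesgue_measure]_y ((`|k|^-1)%:E * \int[lebesgue_measure]_x f (x, y)))%E.
  apply: eq_integral => y _.
  rewrite -(ge0_integral_affine (q / q' * y + (r - r' * (q / q'))) k0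
    (measurableT_comp mf (pair2_measurable y)))//; last by move=> v; exact: f0.
  by apply: eq_integral => x _ /=; congr f; congr pair => /=; ring.
rewrite ge0_integralZl//; last 2 first.
- exact: (measurable_fun_fubini_tonelli_G (m1 := lebesgue_measure) f).
- by move=> x _; apply: integral_ge0 => y _; exact: f0.
rewrite -fubini_tonelli2// muleA -EFinM -invfM -normrM /k.
by congr (((`|_|)^-1)%:E * _)%E; field.
Qed.

Lemma ge0_integral_affine2 (R : realType) (p q r p' q' r' : R)
    (f : R * R -> \bar R) :
  p * q' - q * p' != 0 ->
  measurable_fun [set: R * R] f -> (forall z, 0 <= f z)%E ->
  (\int[lebesgue_measure \x lebesgue_measure]_z
      f (p * z.1 + q * z.2 + r, p' * z.1 + q' * z.2 + r')%R =
   (`|p * q' - q * p'|^-1)%:E *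
   \int[lebesgue_measure \x lebesgue_measure]_z f z)%E.
Proof.
move=> D0 mf f0; have [q'0|] := eqVneq q' 0; last by move=> q'0; exact: ge0_integral_affine2_wlog.
(* Otherwise exchange the two output coordinates. *)
have q0 : q != 0 by apply: contraNneq D0 => ->; rewrite q'0 mulr0 mul0r subrr.
have D'0 : p' * q - q' * p != 0 by rewrite (_ : _ - _ = - (p * q' - q * p')) ?oppr_eq0//; ring.
pose f' := fun z : R * R => f (z.2, z.1).
rewrite -(ge0_integral_swap mf)//.
have mf' : measurable_fun [set: R * R] f'.
  apply: measurableT_comp => //; apply/measurable_fun_pair => /=;
  [exact: measurable_snd|exact: measurable_fst].
rewrite distrC (mulrC q) (mulrC p).
by rewrite -(ge0_integral_affine2_wlog r' r D'0 q0 mf')// => z; exact: f0.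
Qed.

(** * The model integral *)

Lemma is_derive_powR_shift (R : realType) (v x p : R) : 0 < x + v ->
  is_derive x 1 (fun u => (u + v) `^ p) (p * (x + v) `^ (p - 1)).
Proof.
move=> xv.
have := @is_derive1_comp R (fun y => y `^ p) (fun u => u + v) x _ 1 (@is_derive1_powR R p _ xv).
by rewrite mulr1; apply; apply: is_derive_eq; rewrite addr0.
Qed.

Lemma integral_powR_shift (R : realType) (v a b p : R) :
  a < b -> 0 < a + v -> p + 1 != 0 ->
  (\int[lebesgue_measure]_(x in `[a, b]) ((x + v) `^ p)%:E =
   (((b + v) `^ (p + 1) - (a + v) `^ (p + 1)) / (p + 1))%:E)%E.
Proof.
move=> ab av p1.
pose F := (fun u => (p + 1)^-1 * (u + v) `^ (p + 1)) : R -> R.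
have pos x : a <= x -> 0 < x + v by lra.
have dF x : a <= x -> is_derive x 1 F ((x + v) `^ p).
  move=> ax; have := is_derive_powR_shift (p + 1) (pos _ ax); rewrite addrK => H.
  by apply: is_derive_eq; rewrite /GRing.scale /= mulrA mulVf// mul1r.
have cts q x : a <= x -> {for x, continuous (fun u : R => (u + v) `^ q)}.
  move=> ax; apply/differentiable_continuous/derivable1_diffP.
  by have [] := is_derive_powR_shift q (pos _ ax).
have cF x : a <= x -> {for x, continuous F}.
  move=> ax; apply/differentiable_continuous/derivable1_diffP.
  by have [] := dF x ax.
rewrite (@continuous_FTC2 _ _ F)//.
- by rewrite -EFinB /F; congr EFin; field.
- apply: continuous_in_subspaceT => x /[!inE] /=.
  by rewrite in_itv /= => /andP[ax _]; exact: cts.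
- split.
  + by move=> x; rewrite in_itv /= => /andP[ax _]; have [] := dF x (ltW ax).
  + by apply: cvg_at_right_filter; apply: cF.
  + by apply: cvg_at_left_filter; apply: cF; exact: ltW.
- move=> x; rewrite in_itv /= => /andP[ax _]; rewrite derive1E.
  by have [_ ->] := dF x (ltW ax).
Qed.

(** The integrand is unbounded at 0, so the integral is a limit of integrals
    over intervals bounded away from 0. *)
Lemma integral_powRNhalf_le (R : realType) (e : R) : 0 < e ->
  (\int[lebesgue_measure]_(x in `]0%R, e]) (x `^ (- (1 / 2)))%:E <=
   (2 * Num.sqrt e)%:E)%E.
Proof.
move=> e0.
pose F (i : nat) := `[e / i.+2%:R, e]%classic.
have ie (i : nat) : 0 < e / i.+2%:R by rewrite divr_gt0.
have FE : `]0, e]%classic = \bigcup_i F i.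
  apply/seteqP; split=> [x /=|x [i _]]; rewrite /F /= !in_itv /=; last first.
    by move=> /andP[ix ->]; rewrite (lt_le_trans (ie i) ix).
  move=> /andP[x0 xe]; exists (Num.truncn (e / x)) => //; rewrite /F /= in_itv /= xe andbT ler_pdivrMr// -ler_pdivrMl// mulrC.
  rewrite (le_trans (ltW (truncnS_gt _)))// ler_nat.
  exact: leqnSn.
rewrite FE.
have mf : measurable_fun [set: R] (fun x : R => (x `^ (- (1 / 2)))%:E).
  by apply/measurable_EFinP; exact: measurable_powR.
have cvgF : (\int[lebesgue_measure]_(x in F i) (x `^ (- (1 / 2)))%:E @[i --> \oo]
   --> \int[lebesgue_measure]_(x in \bigcup_i F i) (x `^ (- (1 / 2)))%:E)%E.
  apply: ge0_nondecreasing_set_cvg_integral => //.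
  - move=> i j ij; apply/subsetPset => x; rewrite /F /= !in_itv /= => /andP[ix ->].
    rewrite andbT (le_trans _ ix)// ler_pM2l// lef_pV2 ?posrE//.
    by rewrite ler_nat.
  - by move=> i; exact: measurable_itv.
  - by move=> i; exact: measurable_funTS.
  - by move=> i x _; rewrite lee_fin powR_ge0.
rewrite -(cvg_lim _ cvgF)//; apply: lime_le; first by apply/cvg_ex; eexists; exact: cvgF.
apply: nearW => i.
have iei : e / i.+2%:R < e by rewrite ltr_pdivrMr// ltr_pMr// ltr1n.
have := @integral_powR_shift R 0 _ _ (- (1 / 2)) iei.
rewrite !addr0 => /(_ (ie i)) H; under eq_integral do rewrite -[x in x `^ _]addr0.
rewrite H; last by lra.
rewrite lee_fin (_ : - (1 / 2) + 1 = 2^-1); last by lra.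
by rewrite -(powR12_sqrt (ltW e0)) invrK mulrC ler_pM2l// gerBl powR_ge0.
Qed.

(** Up to a constant factor, this dominates the hyperbolic density on a strip of
    width [e] along an edge, near one of the ends of that edge. *)
Definition cusp_kernel (R : realType) (e : R) : R * R -> \bar R :=
  (fun z : R * R => ((z.1 + z.2) `^ (- (3 / 2)))%:E) \_ (`[0, 1] `*` `[0, e]).

Lemma measurable_cusp_kernel (R : realType) (e : R) :
  measurable_fun [set: R * R] (cusp_kernel e).
Proof.
have mD : measurable (`[0%R : R, 1%R] `*` `[0%R, e])%classic.
  by apply: measurableX => //; exact: measurable_itv.
apply/(measurable_restrictT _ mD).
apply: measurable_funTS; apply/measurable_EFinP.
apply: (measurableT_comp (measurable_powR (- (3 / 2)))).
by apply: measurable_funD; [exact: measurable_fst|exact: measurable_snd].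
Qed.

Lemma cusp_kernel_ge0 (R : realType) (e : R) z : (0 <= cusp_kernel e z)%E.
Proof. by apply: erestrict_ge0 => x _; rewrite lee_fin powR_ge0. Qed.

Lemma integral_cusp_kernel_le (R : realType) (e : R) : 0 < e ->
  (\int[lebesgue_measure \x lebesgue_measure]_z cusp_kernel e z <=
   (4 * Num.sqrt e)%:E)%E.
Proof.
move=> e0; have mK := measurable_cusp_kernel e; have K0 := cusp_kernel_ge0 e.
rewrite fubini_tonelli2//.
have mG := measurable_fun_fubini_tonelli_G (m1 := lebesgue_measure) _ mK K0.
(* The inner integral is at most 2 y^(-1/2) for y > 0; the point y = 0 is
   removed from the outer one, since the inner integral diverges there. *)
have K_out x y : y \notin `[0, e] -> cusp_kernel e (x, y) = 0%E.
  move=> ye; rewrite /cusp_kernel patchN//; apply/negP; rewrite inE /= => -[_].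
  by apply/negP.
have -> : (\int[lebesgue_measure]_y fubini_G lebesgue_measure (cusp_kernel e) y =
  \int[lebesgue_measure]_(y in `[0%R, e]) fubini_G lebesgue_measure (cusp_kernel e) y)%E.
  rewrite [RHS]integral_mkcond; apply: eq_integral => y _.
  rewrite /patch; case: ifPn => // /negP; rewrite inE /= => /negP ye.
  by rewrite /fubini_G integral0_eq// => x _; rewrite K_out.
rewrite -integral_itv_obnd_cbnd; last exact: measurable_funTS.
apply: (@le_trans _ _ (\int[lebesgue_measure]_(y in `]0%R, e])
  (2%:E * (y `^ (- (1 / 2)))%:E))%E); last first.
  rewrite ge0_integralZl//; last 2 first.
  - apply: measurable_funTS; apply/measurable_EFinP; exact: measurable_powR.
  - by move=> x _; rewrite lee_fin powR_ge0.
  rewrite (_ : 4 * _ = 2 * (2 * Num.sqrt e)); last by ring.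
  by rewrite EFinM; apply: lee_wpmul2l => //; exact: integral_powRNhalf_le.
apply: ge0_le_integral => //.
- by move=> y _; apply: integral_ge0.
- exact: measurable_funTS.
- apply: measurable_funTS; apply/measurable_EFinP.
  by apply: measurable_funM => //; exact: measurable_powR.
move=> y /=; rewrite in_itv /= => /andP[y0 ye].
have -> : fubini_G lebesgue_measure (cusp_kernel e) y =
  (\int[lebesgue_measure]_(x in `[0%R, 1%R]) ((x + y) `^ (- (3 / 2)))%:E)%E.
  rewrite [RHS]integral_mkcond; apply: eq_integral => x _.
  rewrite /cusp_kernel /patch /=.
  suff -> : ((x, y) \in (`[0, 1] `*` `[0, e])%classic) = (x \in `[0, 1]%classic) by [].
  apply/idP/idP; rewrite !inE /=; first by case.
  by split => //=; rewrite in_itv /= ye ltW.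
rewrite integral_powR_shift//; [|by rewrite add0r|by lra].
rewrite lee_fin add0r (_ : - (3 / 2) + 1 = - (1 / 2)); last by lra.
rewrite invrN mulrN -mulNr opprB div1r invrK mulrC ler_pM2l//.
by rewrite gerBl powR_ge0.
Qed.

(** * Hyperbolic area *)

Lemma norm2_sqr (R : realType) (x : R * R) : norm2 x ^+ 2 = dot x x.
Proof. by rewrite sqr_sqrtr// /dot addr_ge0// -expr2 sqr_ge0. Qed.

Lemma open_diskE (R : realType) : @open_disk R = [set x | dot x x < 1].
Proof.
apply/seteqP; split=> x /=; rewrite /open_disk /= -norm2_sqr expr_lt1// sqrtr_ge0//.
Qed.

Lemma unit_circleP (R : realType) (x : R * R) : unit_circle x -> dot x x = 1.
Proof. by rewrite /unit_circle /= -norm2_sqr => ->; rewrite expr1n. Qed.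

Lemma measurable_dotxx (R : realType) : measurable_fun [set: R * R] (fun x : R * R => dot x x).
Proof.
by apply: measurable_funD; apply: measurable_funM.
Qed.

Lemma measurable_preimage_itv d (T : measurableType d) (R : realType) (f : T -> R)
  (i : interval R) : measurable_fun setT f -> measurable [set x | f x \in i].
Proof.
move=> mf; rewrite -[X in measurable X]setTI.
exact: (mf measurableT [set` i]%classic (measurable_itv i)).
Qed.

Lemma measurable_open_disk (R : realType) : measurable (@open_disk R).
Proof.
rewrite open_diskE; have := @measurable_preimage_itv _ _ R _ `]-oo, 1[ (@measurable_dotxx R).
by under eq_set do rewrite in_itv /=.
Qed.

Lemma measurable_hvol_density (R : realType) :
  measurable_fun [set: R * R] (fun x : R * R => ((1 - norm2 x ^+ 2) `^ (- (3 / 2)))%:E).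
Proof.
apply/measurable_EFinP; apply: (measurableT_comp (measurable_powR (- (3 / 2)))).
under eq_fun do rewrite norm2_sqr.
by apply: measurable_funB => //; exact: measurable_dotxx.
Qed.

(** Monotonicity in the domain without measurability: the integral of a
    nonnegative function is a supremum over simple functions.  Floating bodies
    are uncountable intersections, so this spares a measurability proof. *)
Lemma ge0_integral_subset d (T : measurableType d) (R : realType)
    (mu : {measure set T -> \bar R}) (A B : set T) (f : T -> \bar R) :
  (forall x, 0 <= f x)%E -> A `<=` B ->
  (\int[mu]_(x in A) f x <= \int[mu]_(x in B) f x)%E.
Proof.
move=> f0 AB; rewrite !ge0_integralE//; apply: le_ereal_sup => _ [h hf <-].
exists h => // x; apply: (le_trans (hf x)); rewrite /patch.
case: ifPn => [xA|_]; last by case: ifP.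
by rewrite ifT//; move: xA; rewrite !inE => /AB.
Qed.

Lemma hvol_ge0 (R : realType) (A : set (R * R)) : (0 <= hvol A)%E.
Proof. by apply: integral_ge0 => x _; rewrite lee_fin powR_ge0. Qed.

Lemma le_hvol (R : realType) (A B : set (R * R)) : A `<=` B -> (hvol A <= hvol B)%E.
Proof.
move=> AB; apply: ge0_integral_subset; last exact: setSI.
by move=> x; rewrite lee_fin powR_ge0.
Qed.

Lemma hvol_disjointU (R : realType) (A B : set (R * R)) :
  measurable A -> measurable B -> A `&` B = set0 ->
  hvol (A `|` B) = (hvol A + hvol B)%E.
Proof.
move=> mA mB AB; rewrite /hvol setIUl ge0_integral_setU//.
- by apply: measurableI => //; exact: measurable_open_disk.
- by apply: measurableI => //; exact: measurable_open_disk.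
- by apply: measurable_funTS; exact: measurable_hvol_density.
- by move=> x _; rewrite lee_fin powR_ge0.
- by rewrite disj_set2E setIACA AB set0I.
Qed.

Lemma hvol_setU_le (R : realType) (A B : set (R * R)) :
  measurable A -> measurable B -> (hvol (A `|` B) <= hvol A + hvol B)%E.
Proof.
move=> mA mB; rewrite -(setDUK (@subsetUl _ A B)).
rewrite (_ : _ `\` A = B `\` A); last first.
  by apply/seteqP; split=> x [+ nA]; [case=> // Bx; split | move=> Bx; split=> //; right].
rewrite hvol_disjointU ?setDIK//; last exact: measurableD.
by rewrite leeD2l// le_hvol//; exact: subDsetl.
Qed.

Lemma powRN_le (R : realType) (r x y : R) : 0 <= r -> 0 < x -> x <= y ->
  y `^ (- r) <= x `^ (- r).
Proof.
move=> r0 x0 xy; rewrite !powRN lef_pV2 ?posrE ?powR_gt0//; last exact: lt_le_trans xy.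
by apply: ge0_ler_powR => //; rewrite nnegrE ltW// (lt_le_trans x0).
Qed.

Lemma powR32 (R : realType) (x : R) : 0 <= x -> x `^ (3 / 2) = Num.sqrt x ^+ 3.
Proof.
move=> x0; rewrite -(powR12_sqrt x0) -powR_mulrn ?powR_ge0// -powRrM.
by congr (_ `^ _); rewrite mulrC.
Qed.

Lemma hvol_box_ge (R : realType) (x0 x1 y0 y1 k : R) (A : set (R * R)) :
  x0 <= x1 -> y0 <= y1 -> 0 < k ->
  (forall z : R * R, x0 <= z.1 <= x1 -> y0 <= z.2 <= y1 -> A z /\ 0 < 1 - dot z z <= k) ->
  (((x1 - x0) * (y1 - y0) * k `^ (- (3 / 2)))%:E <= hvol A)%E.
Proof.
move=> x01 y01 k0 H; pose B := (`[x0, x1] `*` `[y0, y1])%classic.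
have mB : measurable (B : set (R * R)) by apply: measurableX => //; exact: measurable_itv.
have BE : (lebesgue_measure \x lebesgue_measure)%E B = ((x1 - x0) * (y1 - y0))%:E.
  rewrite product_measure1E//=.
  rewrite !lebesgue_measure_itv /= !lte_fin.
  case: (ltgtP x0 x1) x01 => // [x01|->] _; last by rewrite subrr mul0r mul0e.
  case: (ltgtP y0 y1) y01 => // -> _.
  by rewrite subrr mulr0 mule0.
have HB z : B z -> A z /\ 0 < 1 - dot z z <= k.
  by move=> [/= z1 z2]; apply: H; rewrite -?in_itv.
apply: (@le_trans _ _ (\int[lebesgue_measure \x lebesgue_measure]_(z in B)
    ((1 - norm2 z ^+ 2) `^ (- (3 / 2)))%:E)%E); last first.
  apply: ge0_integral_subset; first by move=> z; rewrite lee_fin powR_ge0.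
  move=> z /HB [Az /andP[zd _]]; split => //.
  by rewrite open_diskE /= -subr_gt0.
rewrite mulrC EFinM -BE -integral_cst//.
apply: ge0_le_integral => //.
- by move=> z _; rewrite lee_fin powR_ge0.
- by apply: measurable_funTS; exact: measurable_hvol_density.
- move=> z /HB [_ /andP[z0 zk]]; rewrite lee_fin norm2_sqr powRN_le//.
Qed.

(** * Barycentric coordinates *)

Definition sqdist (R : realType) (x y : R * R) : R := dot (x - y) (x - y).

Lemma sqdistE (R : realType) (x y : R * R) :
  sqdist x y = dot x x + dot y y - 2 * dot x y.
Proof. by rewrite /sqdist /dot /=; ring. Qed.

Lemma sqdist_ge0 (R : realType) (x y : R * R) : 0 <= sqdist x y.
Proof. by rewrite /sqdist /dot -!expr2 addr_ge0 ?sqr_ge0. Qed.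

Lemma sqdist_gt0 (R : realType) (x y : R * R) : x <> y -> 0 < sqdist x y.
Proof.
move=> xy; rewrite lt_neqAle sqdist_ge0 andbT; apply/eqP => H; apply: xy.
move: H; rewrite /sqdist /dot -!expr2 => /esym/eqP.
rewrite paddr_eq0 ?sqr_ge0// !sqrf_eq0 /= !subr_eq0 => /andP[/eqP H1 /eqP H2].
by rewrite (surjective_pairing x) H1 H2 -surjective_pairing.
Qed.

(** Twice the signed area of the triangle [p q x]. *)
Definition orient (R : realType) (p q x : R * R) : R :=
  (q.1 - p.1) * (x.2 - p.2) - (q.2 - p.2) * (x.1 - p.1).

Lemma orient_rot (R : realType) (a b c : R * R) : orient b c a = orient a b c.
Proof. by rewrite /orient; ring. Qed.

Lemma orient_swap (R : realType) (a b c : R * R) : orient b a c = - orient a b c.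
Proof. by rewrite /orient; ring. Qed.

(** The coordinate of [x] relative to the first vertex [a].  The other two
    coordinates are [bary b c a x] and [bary c a b x], so statements about one
    vertex pass to the others by rotating the three arguments. *)
Definition bary (R : realType) (a b c x : R * R) : R := orient b c x / orient a b c.

Lemma bary_swap (R : realType) (a b c x : R * R) : bary a c b x = bary a b c x.
Proof.
rewrite /bary (orient_swap b c x) -(orient_rot a c b) (orient_swap b c a).
by rewrite (orient_rot a b c) invrN mulrNN.
Qed.

Lemma bary_sum (R : realType) (a b c x : R * R) : orient a b c != 0 ->
  bary a b c x + bary b c a x + bary c a b x = 1.
Proof.
move=> D0; rewrite /bary -(orient_rot c a b) (orient_rot a b c) -!mulrDl.
by apply: (canLR (mulfK D0)); rewrite mul1r /orient; ring.
Qed.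

Lemma bary_linear (R : realType) (a b c x u : R * R) : orient a b c != 0 ->
  dot u x = bary a b c x * dot u a + bary b c a x * dot u b + bary c a b x * dot u c.
Proof.
move=> D0; rewrite /bary -(orient_rot c a b) (orient_rot a b c).
rewrite -![_ / _ * _]mulrAC -!mulrDl.
by apply: (canRL (mulfK D0)); rewrite /dot /orient; ring.
Qed.

Lemma bary_coord (R : realType) (a b c x : R * R) : orient a b c != 0 ->
  x = (bary a b c x * a.1 + bary b c a x * b.1 + bary c a b x * c.1,
       bary a b c x * a.2 + bary b c a x * b.2 + bary c a b x * c.2).
Proof.
move=> D0; have := bary_linear x (1, 0) D0; have := bary_linear x (0, 1) D0.
rewrite /dot /= !mul0r !mul1r !add0r !addr0 => <- <-; exact: surjective_pairing.
Qed.

Lemma bary_vertex (R : realType) (a b c : R * R) : orient a b c != 0 ->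
  [/\ bary a b c a = 1, bary a b c b = 0 & bary a b c c = 0].
Proof.
move=> D0; rewrite /bary (orient_rot a b c) divff//; split=> //.
  by rewrite (_ : orient b c b = 0) ?mul0r// /orient; ring.
by rewrite (_ : orient b c c = 0) ?mul0r// /orient; ring.
Qed.

Definition segment_point (R : realType) (t : R) (x y : R * R) : R * R :=
  (t * x.1 + (1 - t) * y.1, t * x.2 + (1 - t) * y.2).

Lemma bary_segment (R : realType) (a b c x y : R * R) t :
  bary a b c (segment_point t x y) = t * bary a b c x + (1 - t) * bary a b c y.
Proof. by rewrite /bary /orient /segment_point /=; ring. Qed.

Lemma measurable_orient (R : realType) (p q : R * R) :
  measurable_fun [set: R * R] (orient p q).
Proof.
by apply: measurable_funB; apply: measurable_funM => //; apply: measurable_funB.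
Qed.

Lemma measurable_bary (R : realType) (a b c : R * R) :
  measurable_fun [set: R * R] (bary a b c).
Proof. by apply: measurable_funM => //; exact: measurable_orient. Qed.

Lemma measurable_bary_le (R : realType) (a b c : R * R) (e : R) :
  measurable [set x | bary a b c x <= e].
Proof.
have := @measurable_preimage_itv _ _ R _ `]-oo, e] (@measurable_bary R a b c).
by under eq_set do rewrite in_itv /=.
Qed.

Lemma measurable_bary_ge (R : realType) (a b c : R * R) (e : R) :
  measurable [set x | e <= bary a b c x].
Proof.
have := @measurable_preimage_itv _ _ R _ `[e, +oo[ (@measurable_bary R a b c).
by under eq_set do rewrite in_itv /= andbT.
Qed.

(** The affine map to two of the barycentric coordinates has determinant
    [- (orient a b c)^-1]. *)
Lemma ge0_integral_bary (R : realType) (a b c : R * R) (f : R * R -> \bar R) :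
  orient a b c != 0 ->
  measurable_fun [set: R * R] f -> (forall z, 0 <= f z)%E ->
  (\int[lebesgue_measure \x lebesgue_measure]_z f (bary a b c z, bary c a b z) =
   `|orient a b c|%:E * \int[lebesgue_measure \x lebesgue_measure]_z f z)%E.
Proof.
move=> D0 mf f0; set D := orient a b c.
pose p := - (c.2 - b.2) / D; pose q := (c.1 - b.1) / D.
pose p' := - (b.2 - a.2) / D; pose q' := (b.1 - a.1) / D.
have det : p * q' - q * p' = - D^-1.
  have N : - (c.2 - b.2) * (b.1 - a.1) + (c.1 - b.1) * (b.2 - a.2) = - D.
    by rewrite /D /orient; ring.
  have -> : p * q' - q * p' = (- D) / D / D by rewrite -N /p /q /p' /q'; field.
  by rewrite mulNr divff// mulN1r.
have bE z : (bary a b c z, bary c a b z) =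
  (p * z.1 + q * z.2 + bary a b c 0, p' * z.1 + q' * z.2 + bary c a b 0).
  rewrite /bary -(orient_rot c a b) -/D; congr pair; rewrite /p /q /p' /q' /orient /=; field => //.
under eq_integral do rewrite bE.
by rewrite ge0_integral_affine2 ?det ?oppr_eq0 ?invr_neq0// normrN normfV invrK.
Qed.

(** * Triangles *)

Definition inner_triangle (R : realType) (a b c : R * R) (e : R) : set (R * R) :=
  [set x | [/\ e <= bary a b c x, e <= bary b c a x & e <= bary c a b x]].

Definition triangle (R : realType) (a b c : R * R) : set (R * R) :=
  inner_triangle a b c 0.

Lemma triangle_rot (R : realType) (a b c : R * R) : triangle b c a = triangle a b c.
Proof. by apply/seteqP; split=> x []. Qed.

Lemma measurable_inner_triangle (R : realType) (a b c : R * R) (e : R) :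
  measurable (inner_triangle a b c e).
Proof.
rewrite (_ : inner_triangle a b c e =
  [set x | e <= bary a b c x] `&` [set x | e <= bary b c a x] `&`
  [set x | e <= bary c a b x]); last by apply/seteqP; split=> x [] // [].
by apply: measurableI; first apply: measurableI; exact: measurable_bary_ge.
Qed.

Lemma measurable_triangle (R : realType) (a b c : R * R) : measurable (triangle a b c).
Proof. exact: measurable_inner_triangle. Qed.

Lemma convex_setP (R : realType) (C : set (R * R)) :
  convex_set (M := (R * R)%type) C <->
  (forall x y t, 0 <= t <= 1 -> C x -> C y -> C (segment_point t x y)).
Proof.
split=> [cC x y t /andP[t0 t1] Cx Cy|cC x y t].
  have := cC x y (Itv01 t0 t1); rewrite !inE; exact.
rewrite !inE => Cx Cy; apply: cC => //.
by apply/andP; split; [exact: ge0|exact: le1].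
Qed.

Lemma triangle_convex (R : realType) (a b c : R * R) :
  convex_set (M := (R * R)%type) (triangle a b c).
Proof.
apply/convex_setP => x y t /andP[t0 t1] [x1 x2 x3] [y1 y2 y3].
have t1' : 0 <= 1 - t by rewrite subr_ge0.
by split; rewrite bary_segment addr_ge0// mulr_ge0.
Qed.

Lemma triangle_vertices (R : realType) (a b c : R * R) : orient a b c != 0 ->
  [set a; b; c] `<=` triangle a b c.
Proof.
move=> D0; have D1 : orient b c a != 0 by rewrite orient_rot.
have D2 : orient c a b != 0 by rewrite orient_rot.
have [aa ab ac] := bary_vertex D0; have [bb bc ba] := bary_vertex D1.
have [cc ca cb] := bary_vertex D2.
by move=> _ [[->|->]|->]; split; rewrite ?aa ?ab ?ac ?bb ?bc ?ba ?cc ?ca ?cb.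
Qed.

Lemma convex_hull_triangle (R : realType) (a b c : R * R) : orient a b c != 0 ->
  convex_hull [set a; b; c] = triangle a b c.
Proof.
move=> D0; apply/seteqP; split=> [x|x [al be ga] C [/convex_setP cC abcC]].
  by apply; split; [exact: triangle_convex|exact: triangle_vertices].
have [Ca Cb Cc] : [/\ C a, C b & C c].
  by split; apply: abcC; [left; left|left; right|right].
have S := bary_sum x D0; have X := bary_coord x D0.
move: al be ga S X; set al := bary a b c x; set be := bary b c a x; set ga := bary c a b x.
move=> al0 be0 ga0 S ->.
have [bg|bg] := eqVneq (be + ga) 0.
  have b0 : be = 0 by lra.
  have g0 : ga = 0 by lra.
  have a1 : al = 1 by lra.
  by rewrite b0 g0 a1 !mul0r !mul1r !addr0 -surjective_pairing.
have bg0 : 0 < be + ga by rewrite lt_neqAle eq_sym bg addr_ge0.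
pose y := segment_point (be / (be + ga)) b c.
have Cy : C y.
  apply: cC => //; rewrite divr_ge0 ?(ltW bg0)//= ler_pdivrMr// mul1r; lra.
suff -> : (al * a.1 + be * b.1 + ga * c.1, al * a.2 + be * b.2 + ga * c.2) = segment_point al a y.
  by apply: cC => //; apply/andP; split => //; lra.
have -> : al = 1 - (be + ga) by lra.
rewrite /segment_point /y /=; congr pair; field => //.
Qed.

Definition centroid (R : realType) (a b c : R * R) : R * R :=
  ((a.1 + b.1 + c.1) / 3, (a.2 + b.2 + c.2) / 3).

Lemma centroid_rot (R : realType) (a b c : R * R) : centroid b c a = centroid a b c.
Proof. by rewrite /centroid; congr (_ / _, _ / _); ring. Qed.

Lemma bary_centroid (R : realType) (a b c : R * R) : orient a b c != 0 ->
  bary a b c (centroid a b c) = 1 / 3.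
Proof.
move=> D0; rewrite /bary; apply: (canLR (mulfK D0)).
by rewrite /orient /centroid /=; field.
Qed.

(** * Triangles inscribed in the unit circle *)

Definition ideal_frame (R : realType) (a b c : R * R) : Prop :=
  [/\ dot a a = 1, dot b b = 1, dot c c = 1 & orient a b c != 0].

Lemma ideal_frame_rot (R : realType) (a b c : R * R) :
  ideal_frame a b c -> ideal_frame b c a.
Proof. by move=> [? ? ? ?]; split; rewrite // orient_rot. Qed.

Lemma ideal_frame_neq (R : realType) (a b c : R * R) : ideal_frame a b c -> a <> b.
Proof.
by move=> [_ _ _ /eqP D0] ab; apply: D0; rewrite ab /orient; ring.
Qed.

(** A line meets the circle at most twice.  If the edges from [a] are parallel,
    then projecting [a] on both of them gives
    |b - a|^2 = (b - a).(c - a) = |c - a|^2, whence |b - c|^2 = 0. *)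
Lemma unit_circle_orient_neq0 (R : realType) (a b c : R * R) :
  dot a a = 1 -> dot b b = 1 -> dot c c = 1 ->
  a <> b -> b <> c -> a <> c -> orient a b c != 0.
Proof.
move=> Ha Hb Hc /sqdist_gt0 ab /sqdist_gt0 bc /sqdist_gt0 ac.
have key (p q : R * R) : dot p p = 1 -> dot q q = 1 -> orient a p q = 0 -> 0 < sqdist a p ->
    sqdist a q = dot (p - a) (q - a).
  move=> Hp Hq D0 ap; apply: (mulfI (lt0r_neq0 ap)).
  have E : sqdist a p * dot a (q - a) - dot (p - a) (q - a) * dot a (p - a) =
      orient a p q * (a.2 * (p.1 - a.1) - a.1 * (p.2 - a.2)).
    by rewrite /sqdist /dot /orient /=; ring.
  have tw (z : R * R) : dot z z = 1 -> dot a (z - a) = - (sqdist a z / 2).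
    have : 2 * dot a (z - a) = dot z z - dot a a - sqdist a z.
      by rewrite /dot /sqdist /dot /=; ring.
    by move=> + Hz; rewrite Ha Hz subrr sub0r => H; lra.
  move: E; rewrite D0 mul0r (tw _ Hp) (tw _ Hq) => E.
  apply/eqP; rewrite -subr_eq0; apply/eqP.
  by rewrite -[RHS](mulr0 (- 2)) -E; field.
apply/eqP => D0.
have E1 := key b c Hb Hc D0 ab.
have D1 : orient a c b = 0.
  by rewrite -(orient_rot a c b) orient_swap orient_rot D0 oppr0.
have E2 := key c b Hc Hb D1 ac.
have : sqdist b c = sqdist a b + sqdist a c - 2 * dot (b - a) (c - a).
  by rewrite /sqdist /dot /=; ring.
have -> : sqdist a b = dot (b - a) (c - a) by rewrite E2 /dot; ring.
rewrite E1 => H; lra.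
Qed.

(** Expand |al a + be b + ga c|^2 and subtract it from (al + be + ga)^2 = 1:
    the squares cancel and 2 (1 - a.b) = |a - b|^2. *)
Lemma bary_unit_circle (R : realType) (a b c x : R * R) : ideal_frame a b c ->
  1 - dot x x = bary a b c x * bary b c a x * sqdist a b +
    bary b c a x * bary c a b x * sqdist b c +
    bary c a b x * bary a b c x * sqdist c a.
Proof.
move=> [Ha Hb Hc D0].
have S := bary_sum x D0.
have X := bary_linear x x D0.
have Xa := bary_linear x a D0.
have Xb := bary_linear x b D0.
have Xc := bary_linear x c D0.
have sym (y z : R * R) : dot y z = dot z y by rewrite /dot; ring.
rewrite !sqdistE Ha Hb Hc X (sym x a) (sym x b) (sym x c) Xa Xb Xc.
rewrite (sym b a) (sym c b) (sym a c) Ha Hb Hc.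
have -> : bary c a b x = 1 - bary a b c x - bary b c a x by rewrite -S; ring.
by ring.
Qed.

Lemma triangle_interior_disk (R : realType) (a b c x : R * R) :
  ideal_frame a b c ->
  0 < bary a b c x -> 0 < bary b c a x -> 0 < bary c a b x -> dot x x < 1.
Proof.
move=> F al be ga; have ab := sqdist_gt0 (ideal_frame_neq F).
rewrite -subr_gt0 (bary_unit_circle x F) -addrA ltr_wpDr//.
  have [al0 be0 ga0] := And3 (ltW al) (ltW be) (ltW ga).
  by apply: addr_ge0; apply: mulr_ge0; rewrite ?sqdist_ge0// mulr_ge0.
by apply: mulr_gt0 => //; apply: mulr_gt0.
Qed.

Definition side_min (R : realType) (a b c : R * R) : R :=
  Num.min (sqdist a b) (Num.min (sqdist b c) (sqdist c a)).

Lemma side_min_rot (R : realType) (a b c : R * R) : side_min b c a = side_min a b c.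
Proof. by rewrite /side_min minA minC. Qed.

Lemma side_min_gt0 (R : realType) (a b c : R * R) : ideal_frame a b c -> 0 < side_min a b c.
Proof.
move=> F; rewrite !lt_min !sqdist_gt0//;
  [exact: ideal_frame_neq (ideal_frame_rot (ideal_frame_rot F))
  |exact: ideal_frame_neq (ideal_frame_rot F)|exact: ideal_frame_neq F].
Qed.

(** * Strips along an edge have area at most of order sqrt e *)

(** The constant is the product of [2] (one kernel for each end of the edge), of
    [4] (from the integral of the kernel), of the factor in
    [hvol_density_strip_le] and of the inverse Jacobian of the barycentric
    coordinates. *)
Definition strip_const (R : realType) (a b c : R * R) : R :=
  8 * (side_min a b c / 3) `^ (- (3 / 2)) * `|orient a b c|.

Lemma strip_const_rot (R : realType) (a b c : R * R) : strip_const b c a = strip_const a b c.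
Proof. by rewrite /strip_const side_min_rot orient_rot. Qed.

Lemma strip_const_gt0 (R : realType) (a b c : R * R) : ideal_frame a b c -> 0 < strip_const a b c.
Proof.
move=> F; rewrite /strip_const !mulr_gt0// ?powR_gt0// ?divr_gt0// ?side_min_gt0//.
by rewrite normr_gt0; case: F.
Qed.

(** With [m] the least squared side, 1 - |x|^2 >= m (al be + be ga + ga al).
    The larger of al, be is at least (1 - e) / 2 >= 1 / 3, so this is at least
    (m / 3) (u + ga) where u is the smaller one. *)
Lemma hvol_density_strip_le (R : realType) (a b c : R * R) (e : R) x :
  ideal_frame a b c ->
  e <= 1 / 3 -> triangle a b c x -> bary c a b x <= e -> dot x x < 1 ->
  (((1 - norm2 x ^+ 2) `^ (- (3 / 2)))%:E <=
   ((side_min a b c / 3) `^ (- (3 / 2)))%:E *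
     (cusp_kernel e (bary a b c x, bary c a b x) +
      cusp_kernel e (bary b c a x, bary c a b x)))%E.
Proof.
move=> F e3 [al0 be0 ga0] gae xd; have [_ _ _ D0] := F.
have S := bary_sum x D0; have X := bary_unit_circle x F.
have m0 := side_min_gt0 F; set m := side_min a b c in m0 *.
have mab : m <= sqdist a b by rewrite /m /side_min ge_min lexx.
have mbc : m <= sqdist b c by rewrite /m /side_min !ge_min lexx orbT.
have mca : m <= sqdist c a by rewrite /m /side_min !ge_min lexx !orbT.
move: al0 be0 ga0 gae S X.
set al := bary a b c x; set be := bary b c a x; set ga := bary c a b x.
move=> al0 be0 ga0 gae S X; rewrite norm2_sqr X.
have lower : m * (al * be + be * ga + ga * al) <= 1 - dot x x.
  rewrite X !(mulrDr m); apply: lerD; first apply: lerD.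
  - by rewrite mulrC ler_wpM2l// mulr_ge0.
  - by rewrite mulrC ler_wpM2l// mulr_ge0.
  - by rewrite mulrC ler_wpM2l// mulr_ge0.
have kernelE u : 0 <= u -> u <= 1 -> cusp_kernel e (u, ga) = ((u + ga) `^ (- (3 / 2)))%:E.
  move=> u0 u1; rewrite /cusp_kernel patchT//= inE; split; rewrite /= in_itv /=.
    by rewrite u0 u1.
  by rewrite ga0 gae.
rewrite !kernelE ?(ltW al0)//; [|lra..].
rewrite -EFinD -EFinM lee_fin -X mulrDr.
(* [u] and [v] are the smaller and the larger of al, be; [u + ga] only vanishes
   at a vertex, which is not in the disk. *)
have key u v : 0 <= u -> 0 <= v -> u + v + ga = 1 -> u <= v -> u + ga != 0 ->
    m * (u * v + v * ga + ga * u) <= 1 - dot x x ->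
    (1 - dot x x) `^ (- (3 / 2)) <= (m / 3) `^ (- (3 / 2)) * (u + ga) `^ (- (3 / 2)).
  move=> u0 v0 s uv ug0 low; have v3 : 1 / 3 <= v by lra.
  have low' : m / 3 * (u + ga) <= 1 - dot x x.
    apply: le_trans low; rewrite -mulrA ler_pM2l//.
    have : 0 <= (v - 1 / 3) * (u + ga) by apply: mulr_ge0; lra.
    have : 0 <= ga * u by rewrite mulr_ge0.
    by lra.
  have ug : 0 < u + ga by rewrite lt_neqAle addr_ge0// andbT eq_sym.
  by rewrite -powRM ?divr_ge0 ?(ltW m0) ?(ltW ug)// powRN_le// mulr_gt0// divr_gt0.
have [ab|/ltW ba] := leP al be.
  apply: (le_trans (key al be al0 be0 S ab _ lower)); last first.
    by rewrite lerDl mulr_ge0// powR_ge0.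
  apply/eqP => ag0; have [a00 g00] : al = 0 /\ ga = 0 by split; lra.
  by move: xd; rewrite -subr_gt0 X a00 g00 !(mul0r, mulr0) !addr0 ltxx.
apply: (@le_trans _ _ ((m / 3) `^ (- (3 / 2)) * (be + ga) `^ (- (3 / 2)))); last first.
  by rewrite lerDr mulr_ge0// powR_ge0.
apply: (key be al) => //.
- by rewrite [be + al]addrC.
- apply/eqP => bg0; have [b00 g00] : be = 0 /\ ga = 0 by split; lra.
  by move: xd; rewrite -subr_gt0 X b00 g00 !(mul0r, mulr0) !addr0 ltxx.
- by apply: le_trans lower; rewrite le_eqVlt; apply/orP; left; apply/eqP; ring.
Qed.

Lemma hvol_strip_le (R : realType) (a b c : R * R) (e : R) :
  ideal_frame a b c ->
  0 < e -> e <= 1 / 3 ->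
  (hvol (triangle a b c `&` [set x | (bary c a b x <= e)%R]) <=
   (strip_const a b c * Num.sqrt e)%:E)%E.
Proof.
move=> F e0 e3; have [_ _ _ D0] := F.
set A := _ `&` _; pose M := (side_min a b c / 3) `^ (- (3 / 2)).
have M0 : 0 <= M by rewrite powR_ge0.
pose k1 z := cusp_kernel e (bary a b c z, bary c a b z).
pose k2 z := cusp_kernel e (bary b c a z, bary c a b z).
have k10 z : (0 <= k1 z)%E by exact: cusp_kernel_ge0.
have k20 z : (0 <= k2 z)%E by exact: cusp_kernel_ge0.
have mk1 : measurable_fun [set: R * R] k1.
  apply: measurableT_comp; first exact: measurable_cusp_kernel.
  by apply/measurable_fun_pair; exact: measurable_bary.
have mk2 : measurable_fun [set: R * R] k2.
  apply: measurableT_comp; first exact: measurable_cusp_kernel.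
  by apply/measurable_fun_pair; exact: measurable_bary.
have mA : measurable (A `&` @open_disk R).
  apply: measurableI; last exact: measurable_open_disk.
  apply: measurableI; [exact: measurable_triangle | exact: measurable_bary_le].
apply: (@le_trans _ _ (\int[lebesgue_measure \x lebesgue_measure]_(z in A `&` @open_disk R)
   (M%:E * (k1 z + k2 z)))%E).
  apply: ge0_le_integral => //.
  - by move=> x _; rewrite lee_fin powR_ge0.
  - by apply: measurable_funTS; exact: measurable_hvol_density.
  - apply: measurable_funTS; apply: measurable_funeM; exact: emeasurable_funD.
  - move=> x [[xT xe] xd]; apply: hvol_density_strip_le => //.
    by move: xd; rewrite open_diskE.
apply: (@le_trans _ _ (\int[lebesgue_measure \x lebesgue_measure]_z
   (M%:E * (k1 z + k2 z)))%E).
  by apply: ge0_integral_subset => // x; rewrite mule_ge0 ?lee_fin// adde_ge0.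
rewrite ge0_integralZl//; last 2 first.
- exact: emeasurable_funD.
- by move=> x _; rewrite adde_ge0.
rewrite ge0_integralD// /k1 /k2.
have mK := @measurable_cusp_kernel R e; have K0 := @cusp_kernel_ge0 R e.
rewrite ge0_integral_bary//.
(* The second kernel belongs to the triangle with [a] and [b] exchanged. *)
under [X in (_ + X)%E]eq_integral do rewrite -(bary_swap b c a) -(bary_swap c a b).
rewrite ge0_integral_bary//; last by rewrite orient_swap oppr_eq0.
rewrite (orient_swap a b c) normrN -ge0_muleDl ?lee_fin// -EFinD.
rewrite /strip_const -/M; have -> : 8 * M * `|orient a b c| * Num.sqrt e =
   M * ((`|orient a b c| + `|orient a b c|) * (4 * Num.sqrt e)) by ring.
rewrite 2!EFinM; apply: lee_wpmul2l; rewrite ?lee_fin//.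
apply: lee_wpmul2l; first by rewrite lee_fin addr_ge0.
exact: integral_cusp_kernel_le.
Qed.

Definition strips (R : realType) (a b c : R * R) (e : R) : set (R * R) :=
  (triangle a b c `&` [set x | bary a b c x <= e]) `|`
  ((triangle a b c `&` [set x | bary b c a x <= e]) `|`
   (triangle a b c `&` [set x | bary c a b x <= e])).

Lemma measurable_strip (R : realType) (a b c p q r : R * R) (e : R) :
  measurable (triangle a b c `&` [set x | bary p q r x <= e]).
Proof. by apply: measurableI; [exact: measurable_triangle|exact: measurable_bary_le]. Qed.

Lemma measurable_strips (R : realType) (a b c : R * R) (e : R) : measurable (strips a b c e).
Proof. by do 2![apply: measurableU; first exact: measurable_strip]; exact: measurable_strip. Qed.

Lemma hvol_strips_le (R : realType) (a b c : R * R) (e : R) : ideal_frame a b c ->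
  0 < e -> e <= 1 / 3 ->
  (hvol (strips a b c e) <= (3 * (strip_const a b c * Num.sqrt e))%:E)%E.
Proof.
move=> F e0 e3; have F1 := ideal_frame_rot F; have F2 := ideal_frame_rot F1.
have mS p q r := measurable_strip a b c p q r e.
have s1 := hvol_strip_le F e0 e3.
have s2 := hvol_strip_le F1 e0 e3; rewrite (triangle_rot a b c) (strip_const_rot a b c) in s2.
have s3 := hvol_strip_le F2 e0 e3; rewrite -(triangle_rot c a b) -(strip_const_rot c a b) in s3.
rewrite (_ : 3 * _ = strip_const a b c * Num.sqrt e +
  (strip_const a b c * Num.sqrt e + strip_const a b c * Num.sqrt e)); last by ring.
apply: (le_trans (hvol_setU_le (mS _ _ _) _)); first exact: measurableU.
rewrite EFinD; apply: leeD => //; apply: (le_trans (hvol_setU_le (mS _ _ _) (mS _ _ _))).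
by rewrite EFinD; apply: leeD.
Qed.

Lemma triangle_sub_inner_strips (R : realType) (a b c : R * R) (e : R) :
  triangle a b c `<=` inner_triangle a b c e `|` strips a b c e.
Proof.
move=> x Tx; have [xa|xa] := leP (bary a b c x) e; first by right; left.
have [xb|xb] := leP (bary b c a x) e; first by right; right; left.
have [xc|xc] := leP (bary c a b x) e; first by right; right; right.
by left; split; exact: ltW.
Qed.

(** One of three coordinates of sum 1 is at most 1 / 3, so the three strips of
    width 1 / 3 cover the triangle. *)
Lemma hvol_triangle_fin (R : realType) (a b c : R * R) : ideal_frame a b c ->
  hvol (triangle a b c) \is a fin_num.
Proof.
move=> F; rewrite ge0_fin_numE ?hvol_ge0//.
have e0 : 0 < 1 / 3 :> R by lra.
apply: le_lt_trans (le_lt_trans (hvol_strips_le F e0 (lexx _)) (ltry _)).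
have [_ _ _ D0] := F.
apply: le_hvol => x Tx; have S := bary_sum x D0.
have [xa|xa] := leP (bary a b c x) (1 / 3); first by left.
have [xb|xb] := leP (bary b c a x) (1 / 3); first by right; left.
by right; right; split => //=; lra.
Qed.

(** * Half-planes that reach deep into a cusp cut off area of order sqrt s *)

Lemma unit_coord (R : realType) (a : R * R) : dot a a = 1 ->
  [/\ -1 <= a.1, a.1 <= 1, -1 <= a.2 & a.2 <= 1].
Proof. by rewrite /dot => H; split; nra. Qed.

(** The coordinate is [1 / 3] at the centroid, and on the square it changes by
    at most 2 * 2 * (1 / 24) = 1 / 6, the sides of the triangle having components
    of size at most 2. *)
Lemma bary_centroid_box (R : realType) (a b c y : R * R) : ideal_frame a b c ->
  `|y.1 - (centroid a b c).1| <= `|orient a b c| / 24 ->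
  `|y.2 - (centroid a b c).2| <= `|orient a b c| / 24 ->
  0 < bary a b c y.
Proof.
move=> [_ Hb Hc D0] y1 y2; set g := centroid a b c in y1 y2 *.
have D00 : 0 < `|orient a b c| by rewrite normr_gt0.
have E : bary a b c y = 1 / 3 +
    ((c.1 - b.1) * (y.2 - g.2) - (c.2 - b.2) * (y.1 - g.1)) / orient a b c.
  by rewrite -(bary_centroid D0) -/g /bary -mulrDl; congr (_ / _); rewrite /orient; ring.
have [b1 b1' b2 b2'] := unit_coord Hb; have [c1 c1' c2 c2'] := unit_coord Hc.
have : `|((c.1 - b.1) * (y.2 - g.2) - (c.2 - b.2) * (y.1 - g.1)) / orient a b c| <= 1 / 6.
  rewrite normrM normfV ler_pdivrMr//; apply: (le_trans (ler_normB _ _)).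
  rewrite !normrM (_ : 1 / 6 * _ =
    2 * (`|orient a b c| / 24) + 2 * (`|orient a b c| / 24)); last by field.
  by apply: lerD; apply: ler_pM => //; rewrite ler_norml; lra.
by rewrite ler_norml E; lra.
Qed.

(** With r = |orient a b c| / 24 this is r^2 4^(-3/2): the squared half-side of
    the square around the centroid times the factor of s^(-3/2) in the lower
    bound of the density. *)
Definition cap_const (R : realType) (a b c : R * R) : R := (orient a b c / 24) ^+ 2 / 8.

Lemma cap_const_rot (R : realType) (a b c : R * R) : cap_const b c a = cap_const a b c.
Proof. by rewrite /cap_const orient_rot. Qed.

Lemma cap_const_gt0 (R : realType) (a b c : R * R) : ideal_frame a b c -> 0 < cap_const a b c.
Proof.
move=> [_ _ _ D0]; rewrite divr_gt0 ?ltr0n// exprn_even_gt0//.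
by rewrite mulf_neq0 ?invr_neq0 ?pnatr_eq0.
Qed.

(** A half-plane that contains the centre of a square contains one of its four
    quarters, whatever the direction of its boundary.  For the image of the square
    around the centroid under the homothety of ratio [s] centred at [a], the area
    of the quarter is of order s^2 and the density is at least (4 s)^(-3/2). *)
Lemma hvol_halfplane_ge (R : realType) (a b c : R * R) (s : R) (h : (R * R) * R) :
  ideal_frame a b c ->
  0 < s -> s <= 1 -> h.2 <= dot h.1 (segment_point (1 - s) a (centroid a b c)) ->
  ((cap_const a b c * Num.sqrt s)%:E <= hvol (triangle a b c `&` hplane_pos h))%E.
Proof.
move=> F s0 s1; set g := centroid a b c; set p := segment_point _ _ _ => hp.
have [Ha _ _ D0] := F.
have F1 := ideal_frame_rot F; have F2 := ideal_frame_rot F1.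
pose r := `|orient a b c| / 24.
have r0 : 0 < r by rewrite divr_gt0// normr_gt0.
(* The quarter [x0, x0 + s r] x [y0, y0 + s r] of the square around [p] on which
   neither term of the linear form is less than at [p]. *)
pose x0 := if 0 <= h.1.1 then p.1 else p.1 - s * r.
pose y0 := if 0 <= h.1.2 then p.2 else p.2 - s * r.
have sr0 : 0 < s * r by rewrite mulr_gt0.
have -> : cap_const a b c * Num.sqrt s =
    (x0 + s * r - x0) * (y0 + s * r - y0) * (4 * s) `^ (- (3 / 2)).
  have ss : Num.sqrt s ^+ 2 = s by rewrite sqr_sqrtr// ltW.
  have E (z : R) : z + s * r - z = Num.sqrt s ^+ 2 * r by rewrite ss; ring.
  rewrite !E powRN powR32 ?mulr_ge0 ?(ltW s0)//.
  have s4 : Num.sqrt 4 = 2 :> R.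
    by rewrite (_ : 4 = 2 ^+ 2) ?sqrtr_sqr ?ger0_norm//; ring.
  rewrite sqrtrM// s4.
  have q0 : Num.sqrt s != 0 by rewrite sqrtr_eq0 -ltNge.
  rewrite /r /cap_const expr_div_n -(real_normK (num_real (orient a b c))); field.
  by rewrite q0.
apply: hvol_box_ge; rewrite ?lerDl ?(ltW sr0) ?mulr_gt0// => z z1 z2.
(* [z] is the image of [y] under the homothety of ratio [s] centred at [a]. *)
pose y := (g.1 + (z.1 - p.1) / s, g.2 + (z.2 - p.2) / s).
have zE : z = segment_point (1 - s) a y.
  rewrite [LHS]surjective_pairing /segment_point /y /p /segment_point /=.
  by congr pair; field; rewrite gt_eqF.
have zp1 : `|z.1 - p.1| <= s * r.
  by move: z1; rewrite /x0; case: ifP => _ /andP[? ?]; rewrite ler_norml; lra.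
have zp2 : `|z.2 - p.2| <= s * r.
  by move: z2; rewrite /y0; case: ifP => _ /andP[? ?]; rewrite ler_norml; lra.
have yb1 : `|y.1 - g.1| <= r.
  rewrite /y /= [_ + _ - _]addrC addKr normrM normfV (gtr0_norm s0).
  by rewrite ler_pdivrMr// (mulrC r).
have yb2 : `|y.2 - g.2| <= r.
  rewrite /y /= [_ + _ - _]addrC addKr normrM normfV (gtr0_norm s0).
  by rewrite ler_pdivrMr// (mulrC r).
have al : 0 < bary a b c y by exact: bary_centroid_box.
have be : 0 < bary b c a y.
  by apply: bary_centroid_box; rewrite ?(orient_rot a b c) ?(centroid_rot a b c).
have ga : 0 < bary c a b y.
  by apply: bary_centroid_box; rewrite -?(orient_rot c a b) -?(centroid_rot c a b).
have yd : dot y y < 1 by exact: (triangle_interior_disk F al be ga).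
have tri : triangle a b c z.
  rewrite zE; have [? ? ?] := bary_vertex D0.
  have : triangle a b c a by apply: triangle_vertices => //; left; left.
  have : triangle a b c y by split; exact: ltW.
  move=> ty ta; have /convex_setP cT := @triangle_convex R a b c.
  by apply: cT => //; lra.
have dz : 1 - dot z z = s * (2 * (1 - dot a y) - s * sqdist a y).
  rewrite zE (_ : dot (segment_point _ _ _) _ =
    dot a a - s * (2 * dot a a - 2 * dot a y) + s ^+ 2 * sqdist a y).
    by rewrite Ha; ring.
  by rewrite /sqdist /dot /segment_point /=; ring.
have sqE : sqdist a y = 1 + dot y y - 2 * dot a y by rewrite sqdistE Ha.
have ay : 0 <= sqdist a y by exact: sqdist_ge0.
have ay' : -1 < dot a y.
  have : 0 <= sqdist a (- y) by exact: sqdist_ge0.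
  have -> : sqdist a (- y) = 1 + dot y y + 2 * dot a y.
    by rewrite sqdistE Ha /dot /=; ring.
  by lra.
have kdisk : 0 < 1 - dot z z <= 4 * s.
  rewrite dz; apply/andP; split.
    rewrite mulr_gt0//.
    have : s * sqdist a y <= sqdist a y by rewrite ler_piMl.
    by lra.
  rewrite mulrC ler_pM2r//.
  have : 0 <= s * sqdist a y by rewrite mulr_ge0// ltW.
  by lra.
split=> //; split=> //; split; first by rewrite open_diskE /= -subr_gt0; case/andP: kdisk.
apply: (le_trans hp); rewrite /= /dot.
apply: lerD.
  move: z1; rewrite /x0; case: ifPn => [u0|]; last rewrite -ltNge => u0; move=> /andP[? ?].
    by rewrite ler_wpM2l.
  by rewrite ler_wnM2l ?(ltW u0)//; lra.
move: z2; rewrite /y0; case: ifPn => [u0|]; last rewrite -ltNge => u0; move=> /andP[? ?].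
  by rewrite ler_wpM2l.
by rewrite ler_wnM2l ?(ltW u0)//; lra.
Qed.

(** * Half-planes cut off by lines parallel to an edge *)

Definition edge_halfplane (R : realType) (a b c : R * R) (e : R) : (R * R) * R :=
  let u := ((b.2 - a.2) / orient a b c, - ((b.1 - a.1) / orient a b c)) in
  (u, dot u a - e).

Lemma edge_halfplane_dot (R : realType) (a b c : R * R) e x :
  dot (edge_halfplane a b c e).1 x - (edge_halfplane a b c e).2 = e - bary c a b x.
Proof.
by rewrite /edge_halfplane /bary -(orient_rot c a b) /dot /= [in RHS]/orient; ring.
Qed.

Lemma edge_halfplane_posE (R : realType) (a b c : R * R) e x :
  hplane_pos (edge_halfplane a b c e) x <-> open_disk x /\ bary c a b x <= e.
Proof.
by rewrite /hplane_pos /= -subr_ge0 edge_halfplane_dot subr_ge0.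
Qed.

Lemma edge_halfplane_negE (R : realType) (a b c : R * R) e x :
  hplane_neg (edge_halfplane a b c e) x <-> open_disk x /\ e <= bary c a b x.
Proof.
by rewrite /hplane_neg /= -subr_le0 edge_halfplane_dot subr_le0.
Qed.

Lemma edge_halfplane_geodesic (R : realType) (a b c : R * R) e :
  ideal_frame a b c -> 0 < e -> e < 1 -> oriented_geodesic (edge_halfplane a b c e).
Proof.
move=> F e0 e1; have [_ _ _ D0] := F.
have [aa ab ac] := bary_vertex D0.
have [bb bc ba] : [/\ bary b c a b = 1, bary b c a c = 0 & bary b c a a = 0].
  by apply: bary_vertex; rewrite orient_rot.
have [cc ca cb] : [/\ bary c a b c = 1, bary c a b a = 0 & bary c a b b = 0].
  by apply: bary_vertex; rewrite -orient_rot.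
split.
  move=> u0; have := edge_halfplane_dot a b c e a; have := edge_halfplane_dot a b c e c.
  by rewrite u0 ca cc /dot /= !mul0r; lra.
(* The point with barycentric coordinates (1 - e)/2, (1 - e)/2, e. *)
pose x := segment_point e c (segment_point (1 / 2) a b).
have xc : bary c a b x = e by rewrite /x !bary_segment cc ca cb; ring.
have xa : 0 < bary a b c x by rewrite /x !bary_segment ac aa ab; lra.
have xb : 0 < bary b c a x by rewrite /x !bary_segment bc ba bb; lra.
exists x; split.
  rewrite open_diskE /=.
  apply: (triangle_interior_disk F xa xb).
  by rewrite xc.
by apply/eqP; rewrite -subr_eq0 edge_halfplane_dot xc subrr.
Qed.

(** * The floating body of an ideal triangle *)

Lemma floating_body_edge (R : realType) (a b c : R * R) (e delta : R) :
  ideal_frame a b c -> 0 < e -> e <= 1 / 3 -> strip_const a b c * Num.sqrt e <= delta ->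
  floating_body (triangle a b c) delta `<=` [set x | e <= bary c a b x].
Proof.
move=> F e0 e3 ed x /(_ (edge_halfplane a b c e)).
case/(_ _)/edge_halfplane_negE => //; split; first by apply: edge_halfplane_geodesic => //; lra.
apply: (@le_trans _ _ (strip_const a b c * Num.sqrt e)%:E); last by rewrite lee_fin.
apply: le_trans (hvol_strip_le F e0 e3); apply: le_hvol => y [Ty /edge_halfplane_posE[_ ?]].
by split.
Qed.

(** A half-plane that meets the inner triangle contains one of its vertices
    (1 - s) v + s g, because a linear form is maximal at a vertex. *)
Lemma inner_triangle_sub_floating_body (R : realType) (a b c : R * R) (s delta : R) :
  ideal_frame a b c -> 0 < s -> s < 1 -> delta < cap_const a b c * Num.sqrt s ->
  inner_triangle a b c (s / 3) `<=` floating_body (triangle a b c) delta.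
Proof.
move=> F s0 s1 sd x [xa xb xc] h [_ hd]; have [_ _ _ D0] := F.
have s3 : 0 < s / 3 by rewrite divr_gt0.
split; first rewrite open_diskE /=.
  by apply: (triangle_interior_disk F); apply: lt_le_trans s3 _.
have key p q r : ideal_frame p q r -> cap_const p q r = cap_const a b c ->
    triangle p q r = triangle a b c -> centroid p q r = centroid a b c ->
    dot h.1 (segment_point (1 - s) p (centroid a b c)) < h.2.
  move=> Fp capE TE <-; rewrite ltNge; apply/negP => hp.
  have := hvol_halfplane_ge Fp s0 (ltW s1) hp.
  rewrite capE TE => /le_trans /(_ hd).
  by rewrite lee_fin leNgt sd.
have ka := key _ _ _ F erefl erefl erefl.
have kb := key _ _ _ (ideal_frame_rot F)
  (cap_const_rot _ _ _) (triangle_rot _ _ _) (centroid_rot _ _ _).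
have kc : dot h.1 (segment_point (1 - s) c (centroid a b c)) < h.2.
  apply: (key c a b); first exact/ideal_frame_rot/ideal_frame_rot.
  - by rewrite -(cap_const_rot c a b).
  - by rewrite -(triangle_rot c a b).
  - by rewrite -(centroid_rot c a b).
(* (1 - s) x is the combination of the three vertices with the nonnegative
   coefficients bary x - s / 3, of sum 1 - s. *)
rewrite /= -subr_le0 -(@pmulr_rle0 _ (1 - s)) ?subr_gt0//.
have S := bary_sum x D0.
have -> : (1 - s) * (dot h.1 x - h.2) =
   (bary a b c x - s / 3) * (dot h.1 (segment_point (1 - s) a (centroid a b c)) - h.2) +
   (bary b c a x - s / 3) * (dot h.1 (segment_point (1 - s) b (centroid a b c)) - h.2) +
   (bary c a b x - s / 3) * (dot h.1 (segment_point (1 - s) c (centroid a b c)) - h.2).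
  rewrite (bary_linear x h.1 D0).
  have -> : bary c a b x = 1 - bary a b c x - bary b c a x by rewrite -S; ring.
  by rewrite /dot /segment_point /centroid /=; field.
have tm u v : s / 3 <= u -> v < h.2 -> (u - s / 3) * (v - h.2) <= 0.
  by move=> u0 vh; rewrite mulr_ge0_le0 ?subr_ge0// subr_le0 ltW.
by have := lerD (lerD (tm _ _ xa ka) (tm _ _ xb kb)) (tm _ _ xc kc); rewrite !addr0.
Qed.

Lemma floating_body_upper (R : realType) (a b c : R * R) (delta : R) : ideal_frame a b c ->
  0 < delta -> delta < cap_const a b c / 2 ->
  (hvol (triangle a b c) <= hvol (floating_body (triangle a b c) delta) +
     (6 * strip_const a b c / cap_const a b c * delta)%:E)%E.
Proof.
move=> F d0 dc; have c0 := cap_const_gt0 F; have C0 := strip_const_gt0 F.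
(* cap_const * sqrt s = 2 delta for s = q ^ 2. *)
pose q := 2 * delta / cap_const a b c.
have q0 : 0 < q by rewrite divr_gt0// mulr_gt0.
have q1 : q < 1 by rewrite ltr_pdivrMr// mul1r; lra.
pose s := q ^+ 2.
have s0 : 0 < s by rewrite exprn_gt0.
have s1 : s < 1 by rewrite expr_lt1// ltW.
have sq : Num.sqrt s = q by rewrite sqrtr_sqr gtr0_norm.
have sub : inner_triangle a b c (s / 3) `<=` floating_body (triangle a b c) delta.
  apply: inner_triangle_sub_floating_body => //; rewrite sq /q mulrC divfK ?gt_eqF//; lra.
have s30 : 0 < s / 3 by lra.
have s33 : s / 3 <= 1 / 3 by lra.
apply: (le_trans (le_hvol (@triangle_sub_inner_strips R a b c (s / 3)))).
apply: (le_trans (hvol_setU_le (measurable_inner_triangle _ _ _ _) (measurable_strips _ _ _ _))).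
apply: leeD; first exact: le_hvol.
apply: (le_trans (hvol_strips_le F s30 s33)); rewrite lee_fin.
have : Num.sqrt (s / 3) <= q by rewrite -sq ler_wsqrtr//; lra.
move=> H; rewrite (_ : 6 * _ / _ * _ = 3 * (strip_const a b c * q)).
  by rewrite ler_pM2l// ler_pM2l.
by rewrite /q; field; rewrite gt_eqF.
Qed.

Lemma floating_body_lower (R : realType) (a b c : R * R) (delta : R) : ideal_frame a b c ->
  0 < delta -> delta < strip_const a b c / 2 ->
  (hvol (floating_body (triangle a b c) delta) +
    (cap_const a b c / strip_const a b c * delta)%:E <= hvol (triangle a b c))%E.
Proof.
move=> F d0 dc; have c0 := cap_const_gt0 F; have C0 := strip_const_gt0 F.
have F1 := ideal_frame_rot F; have F2 := ideal_frame_rot F1.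
(* strip_const * sqrt e = delta for e = q ^ 2. *)
pose q := delta / strip_const a b c.
have q0 : 0 < q by rewrite divr_gt0.
have q1 : q < 1 / 2 by rewrite ltr_pdivrMr//; lra.
pose e := q ^+ 2.
have e0 : 0 < e by rewrite exprn_gt0.
have e1 : e <= 1 / 3 by rewrite /e expr2; nra.
have eq : Num.sqrt e = q by rewrite sqrtr_sqr gtr0_norm.
have Ce : strip_const a b c * Num.sqrt e <= delta.
  by rewrite eq /q mulrC divfK ?gt_eqF.
have sc : floating_body (triangle a b c) delta `<=` [set x | e <= bary c a b x].
  exact: floating_body_edge.
have sa : floating_body (triangle a b c) delta `<=` [set x | e <= bary a b c x].
  by rewrite -(triangle_rot a b c); apply: floating_body_edge; rewrite ?(strip_const_rot a b c).
have sb : floating_body (triangle a b c) delta `<=` [set x | e <= bary b c a x].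
  by rewrite (triangle_rot c a b); apply: floating_body_edge; rewrite -?(strip_const_rot c a b).
pose A := triangle a b c `&` [set x | e <= bary c a b x].
pose B := triangle a b c `\` [set x | e <= bary c a b x].
have TE : triangle a b c = A `|` B by rewrite /A /B setUIDK.
have mT := measurable_triangle a b c; have mge := measurable_bary_ge c a b e.
have mA : measurable A by exact: measurableI.
have mB : measurable B by exact: measurableD.
rewrite [leRHS](_ : _ = hvol A + hvol B)%E; last first.
  rewrite [in LHS]TE hvol_disjointU//.
  by apply/seteqP; split=> x // [[_ ?] [_ ?]].
apply: leeD.
  apply: le_hvol => x Fx; split; last exact: sc.
  by split; apply: ltW; apply: (lt_le_trans e0); [exact: sa|exact: sb|exact: sc].
have [_ _ _ D0] := F.
rewrite (_ : cap_const a b c / _ * _ = cap_const a b c * Num.sqrt e); last first.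
  by rewrite eq /q mulrAC mulrA.
have e1' : e <= 1 by lra.
(* The point at parameter e on the segment from [a] to the centroid has third
   coordinate e / 3, so it lies in the half-plane of width e / 2, whose part in
   the triangle is missed by the floating body. *)
apply: (le_trans (hvol_halfplane_ge (h := edge_halfplane a b c (e / 2)) F e0 e1' _)).
  rewrite -subr_ge0 edge_halfplane_dot bary_segment.
  have -> : bary c a b (centroid a b c) = 1 / 3.
    by rewrite (centroid_rot c a b) bary_centroid// -orient_rot.
  have -> : bary c a b a = 0.
    by have [] := @bary_vertex R c a b; rewrite -?(orient_rot c a b).
  by lra.
apply: le_hvol => x [Tx /edge_halfplane_posE[_ xe]]; split=> //= ex; lra.
Qed.

Theorem theorem5p3 (R : realType) (T : set (R * R)) (hT : ideal_triangle T) :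
  exists delta0 C1 C2 : R, [/\ 0 < delta0, 0 < C1, 0 < C2 &
    forall delta : R, 0 < delta -> delta < delta0 ->
      (C1%:E <= (hvol T - hvol (floating_body T delta)) * (delta^-1)%:E <= C2%:E)%E].
Proof.
have [a [b [c [[/unit_circleP Ha /unit_circleP Hb /unit_circleP Hc] [[ab bc ac] TE]]]]] := hT.
have D0 : orient a b c != 0 by exact: unit_circle_orient_neq0.
have F : ideal_frame a b c by [].
have {TE} -> : T = triangle a b c by rewrite TE convex_hull_triangle.
have c0 := cap_const_gt0 F; have C0 := strip_const_gt0 F.
exists (Num.min (cap_const a b c / 2) (strip_const a b c / 2)).
exists (cap_const a b c / strip_const a b c), (6 * strip_const a b c / cap_const a b c).
split; [|exact: divr_gt0|by apply: divr_gt0 => //; exact: mulr_gt0|].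
  by rewrite lt_min; apply/andP; split; exact: divr_gt0.
move=> delta d0; rewrite lt_min => /andP[dc dC].
have := floating_body_lower F d0 dC; have := floating_body_upper F d0 dc.
have Tfin := hvol_triangle_fin F.
set V := hvol (triangle a b c) in Tfin *; set W := hvol (floating_body _ _) => up low.
have W0 : (0 <= W)%E by exact: hvol_ge0.
have Wfin : W \is a fin_num.
  rewrite ge0_fin_numE//; apply: le_lt_trans (_ : V < +oo)%E; last first.
    by rewrite -ge0_fin_numE// hvol_ge0.
  apply: (le_trans _ low); apply: leeDl.
  by rewrite lee_fin ltW// mulr_gt0// divr_gt0.
move: up low; rewrite -(fineK Tfin) -(fineK Wfin) -!EFinD !lee_fin => up low.
by rewrite ler_pdivlMr// ler_pdivrMr//; apply/andP; split; lra.
Qed.
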